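(* Suppose $G$ is a finite group admitting a skew-Hadamard difference set, and let $G'=[G,G]$ be its commutator subgroup. Then $\sqrt{-|G|}\in\mathbb{Q}(\zeta_d)$ for all positive integers $d$ such that there is a cyclic subgroup of order $d$ in $G/G'$, where $\zeta_d$ denotes a primitive $d$-th root of unity.
   Context: Let $G$ be a finite group of order $v$. A $(v,k,\lambda)$ difference set in $G$ is a subset $D\subseteq G$ of size $k$ such that each non-identity element of $G$ can be written as $d_1d_2^{-1}$ with $d_1\neq d_2$ in $D$ in exactly $\lambda$ distinct ways. A skew-Hadamard difference set (SHDS) in $G$ is a difference set $D$ such that $G$ is the disjoint union of $D$, $D^{(-1)}$ and $\{1\}$, where $D^{(-1)}=\{d^{-1}: d\in D\}$. We say that $G$ admits an SHDS if such a $D\subseteq G$ exists.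
   Formalization: The claim is stated for integers d > 1 only: for d = 1 it fails for every G, since the trivial subgroup is cyclic of order 1 and √(-|G|) is not in ℚ(ζ_1) = ℚ. *)

(* Defs.v *)
From mathcomp Require Import all_boot all_order all_fingroup all_algebra all_solvable all_field.

Set Implicit Arguments.
Unset Strict Implicit.
Unset Printing Implicit Defensive.

Local Open Scope group_scope.

Definition difference_set (gT : finGroupType) (G : {group gT})
    (v k lambda : nat) (D : {set gT}) : Prop :=
  [/\ #|G| = v, D \subset G, #|D| = k &
      forall g, g \in G -> g != 1 ->
        #|[set p in setX D D | (p.1 != p.2) && (p.1 * p.2^-1 == g)]| = lambda].

(* [D^-1] is the pointwise inverse set, i.e. the D^(-1) of the literature. *)
Definition skew_hadamard_difference_set (gT : finGroupType) (G : {group gT})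
    (D : {set gT}) : Prop :=
  [/\ exists v k lambda, difference_set G v k lambda D,
      D :|: D^-1 :|: [set 1] = G :> {set gT},
      [disjoint D & D^-1], [disjoint D & [set 1]] &
      [disjoint D^-1 & [set 1]]].

Definition admits_SHDS (gT : finGroupType) (G : {group gT}) : Prop :=
  exists D : {set gT}, skew_hadamard_difference_set G D.

(* x lies in Q(z), the smallest subfield of algC containing z; every
   [divring_closed] subset of a field is a subfield, and so contains Q. *)
Definition in_Qadjoin (z x : algC) : Prop :=
  forall K : {pred algC}, GRing.divring_closed K -> z \in K -> x \in K.

(* Main.v *)
Require Import Defs.
From HB Require Import structures.
From mathcomp Require Import all_boot all_order all_fingroup all_algebra all_solvable all_field.
From mathcomp Require Import classfun character ring.
Import Num.Theory.

(* For a nontrivial linear character xi of G and s the sum of xi over D, the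
   partition of G gives xi(D^-1) = -1 - s, and the difference set equation gives
   s * xi(D^-1) = k - lambda = (|G| + 1) / 4; hence (2 s + 1)^2 = - |G|.  As the
   linear characters of G form a group of order #|G / G'|, Cauchy's theorem
   provides a character xi of prime order p dividing d; its values, and hence
   2 s + 1, lie in Q(zeta). *)

Import GroupScope GRing.Theory.
Local Open Scope ring_scope.

Lemma sum_lin_char_eq0 {gT : finGroupType} {G : {group gT}} (xi : 'CF(G)) :
  xi \is a linear_char -> xi != 1 -> \sum_(x in G) xi x = 0.
Proof.
move=> xi_lin; apply: contraNeq => sum_neq0.
apply/eqP/cfun_inP=> h Gh; rewrite cfun1E Gh.
(* Translating by [h] multiplies the sum by [xi h], so a nonzero sum forces [xi h = 1]. *)
apply: (mulIf sum_neq0); rewrite mul1r [RHS](reindex_inj (mulgI h)) mulr_sumr.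
apply: eq_big => x; first by rewrite groupMl.
by move=> Gx; rewrite lin_charM.
Qed.

(** The product expands into the sum of [xi (a * b^-1)] over pairs of [D], grouped by quotient: 1
    arises from the [k] diagonal pairs, any other element of [G] from [lambda] pairs. *)
Lemma lin_char_difference_set {gT : finGroupType} {G : {group gT}}
    {v k lambda : nat} {D : {set gT}} (xi : 'CF(G)) :
    xi \is a linear_char -> difference_set G v k lambda D ->
  (\sum_(x in D) xi x) * (\sum_(x in D^-1%g) xi x)
    = k%:R + lambda%:R * (\sum_(x in G) xi x - 1).
Proof.
move=> xi_lin [_ sDG card_D diffD]; have inG x := subsetP sDG x.
pose quot (p : gT * gT) := (p.1 * p.2^-1)%g.
have fiber x : \sum_(p | (p \in setX D D) && (quot p == x)) xi (quot p)
    = #|[set p in setX D D | quot p == x]|%:R * xi x.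
  rewrite mulr_natl -sumr_const; apply: eq_big => [p | p /andP[_ /eqP->] //].
  by rewrite !inE.
have card_fiber1 : #|[set p in setX D D | quot p == 1%g]| = k.
  rewrite -card_D -(card_imset (mem D) (f := fun x => (x, x))); last by move=> x y [].
  apply: eq_card => -[a b]; rewrite !inE /quot /= -eq_mulgV1.
  apply/andP/imsetP=> [[/andP[Da _] /eqP <-] | [x Dx [-> ->]]]; first by exists a.
  by rewrite eqxx Dx.
have card_fiberN1 x : x \in G -> x != 1%g ->
    #|[set p in setX D D | quot p == x]| = lambda.
  move=> Gx nx1; rewrite -(diffD x Gx nx1); apply: eq_card => -[a b]; rewrite !inE.
  (* Since [x != 1], the condition [p.1 != p.2] of [difference_set] is automatic here. *)
  congr (_ && _); rewrite /quot /= andbC; case: eqP => //= def_x.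
  by rewrite eq_mulgV1 def_x.
transitivity (\sum_(p in setX D D) xi (quot p)).
  have -> : \sum_(x in D^-1%g) xi x = \sum_(x in D) xi x^-1%g.
    by rewrite (reindex_inj invg_inj); apply: eq_bigl => x; rewrite inE invgK.
  rewrite mulr_suml; under eq_bigr do rewrite mulr_sumr.
  rewrite pair_big /=; apply: eq_big => [[a b] | [a b] /andP[/= Da Db]].
    by rewrite !inE.
  by rewrite lin_charM ?groupV ?inG.
rewrite (partition_big quot (mem G)) /=; last first.
  by move=> [a b]; rewrite inE /quot => /andP[/inG Ga /inG Gb]; rewrite groupM ?groupV.
rewrite (bigD1 1%g) //= fiber card_fiber1 lin_char1 // mulr1; congr (_ + _).
rewrite [X in _ * (X - _)](bigD1 1%g) //= lin_char1 // addrAC subrr add0r mulr_sumr.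
by apply: eq_bigr => x /andP[Gx nx1]; rewrite fiber card_fiberN1.
Qed.

Lemma lin_char_SHDS_sqr {gT : finGroupType} {G : {group gT}} {D : {set gT}}
    (xi : 'CF(G)) :
    skew_hadamard_difference_set G D -> xi \is a linear_char -> xi != 1 ->
  (2%:R * \sum_(x in D) xi x + 1) ^+ 2 = - #|G|%:R.
Proof.
move=> [[v [k [lambda dsD]]] defG disDV disD1 disDV1] xi_lin xi_neq1.
have [_ _ cardD _] := dsD.
have split (F : gT -> algC) :
    \sum_(x in G) F x = \sum_(x in D) F x + \sum_(x in D^-1%g) F x + F 1%g.
  have sumU (A B : {set gT}) : [disjoint A & B] ->
      \sum_(x in A :|: B) F x = \sum_(x in A) F x + \sum_(x in B) F x.
    by move=> disAB; rewrite -bigU //; apply: eq_bigl => x; rewrite !inE.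
  rewrite -defG !sumU ?big_set1 //.
  by rewrite disjoints_subset subUset -!disjoints_subset disD1.
have cardG : #|G|%:R = 2%:R * k%:R + 1 :> algC.
  have := split (fun=> 1); rewrite !sumr_const card_invg cardD => ->; ring.
(* If [k = 0] then [G] is trivial and has no linear character other than 1. *)
have k_neq0 : k%:R != 0 :> algC.
  apply: contraNneq xi_neq1 => k0; apply/eqP/cfun_inP => x Gx.
  have /eqP := cardG; rewrite k0 mulr0 add0r pnatr_eq1 => /eqP/card1_trivg G1.
  have /set1P-> : x \in [1 gT] by rewrite -G1.
  by rewrite cfun1E group1 lin_char1.
(* At the trivial character the difference set equation reads [k ^ 2 = k + lambda * (2 * k)]; cancel
   [k]. *)
have def_k : k%:R = 1 + 2%:R * lambda%:R :> algC.
  have sum1 (A : {set gT}) : A \subset G -> \sum_(x in A) (1 : 'CF(G)) x = #|A|%:R.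
    move=> /subsetP sAG; rewrite -sumr_const.
    by apply: eq_bigr => x /sAG Gx; rewrite cfun1E Gx.
  have := lin_char_difference_set _ (cfun1_lin_char G) dsD.
  rewrite !sum1 ?card_invg ?cardD ?cardG //; last 2 first.
  - by rewrite -defG setUAC subsetUr.
  - by rewrite -defG -setUA subsetUl.
  move=> eqk; apply: (mulfI k_neq0); rewrite eqk; ring.
have sumG := split xi; rewrite sum_lin_char_eq0 // lin_char1 // in sumG.
have := lin_char_difference_set _ xi_lin dsD; rewrite sum_lin_char_eq0 // cardG.
move: sumG; set s := \sum_(x in D) _; set t := \sum_(x in _) _ => sumG eqst.
(* Shaped so that [sumG], i.e. [0 = s + t + 1], turns [t] into [0 - 1 - s]. *)
have def_t : t = s + t + 1 - 1 - s by ring.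
move: eqst; rewrite def_t -sumG def_k => eqst.
(* Here [s * t = k - lambda = 1 + lambda], so both sides equal [-(4 * lambda + 3)]. *)
transitivity (1 - 4%:R * (s * (0 - 1 - s))); first by ring.
rewrite eqst; ring.
Qed.

Lemma exists_lin_char_prime_order {gT : finGroupType} (G : {group gT}) (p : nat) :
    prime p -> (p %| #|(G / [~: G, G])%g|)%N ->
  exists xi : 'CF(G), [/\ xi \is a linear_char, xi != 1 & xi ^+ p = 1].
Proof.
move=> p_pr; have [linG [cF [cF_inj card_linG cF_lin _] [cF1 _ cFX _ _]]] := lin_char_group G.
rewrite card_quotient ?(der_norm 1) //= -derg1 -card_linG -cardsT => p_dv.
have [u _ ord_u] := Cauchy p_pr p_dv.
exists (cF u); split=> //; last by rewrite -cFX -ord_u expg_order.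
rewrite -cF1 (inj_eq cF_inj) -order_eq1 ord_u.
by rewrite neq_ltn prime_gt1 ?orbT.
Qed.

Theorem theorem2p2 (gT : finGroupType) (G : {group gT}) :
  admits_SHDS G ->
  forall d : nat, (1 < d)%N ->
    (exists H : {group coset_of [~: G, G]%g},
        [/\ H \subset (G / [~: G, G])%g, cyclic H & #|H| = d]) ->
    forall zeta : algC, (d.-primitive_root zeta)%R ->
      in_Qadjoin zeta (sqrtC (- (#|G|%:R)))%R.
Proof.
move=> [D shD] d d_gt1 [H [sHG _ cardH]] zeta prim_zeta K divK Kzeta.
(* This is where [1 < d] enters; for [d = 1] the claim would make the square root of a negative
   integer rational. *)
have [p p_pr p_dv_d] : exists2 p, prime p & (p %| d)%N.
  by exists (pdiv d); rewrite ?pdiv_prime ?pdiv_dvd.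
have p_dv : (p %| #|(G / [~: G, G])%g|)%N.
  by rewrite (dvdn_trans p_dv_d) // -cardH cardSg.
have [xi [xi_lin xi_neq1 xiX]] := exists_lin_char_prime_order _ _ p_pr p_dv.
(* Packing [K] as a [divringClosed] structure makes the [rpred] lemmas apply to it. *)
pose KM := GRing.isDivringClosed.Build _ (K : algC -> bool) divK.
pose Kring : divringClosed algC := HB.pack (K : algC -> bool) KM.
have Kxi x : x \in D -> xi x \in Kring.
  move=> Dx; have Gx : x \in G.
    by have [[v [k [l [_ /subsetP sDG _ _]]]] _ _ _ _] := shD; apply: sDG.
  have : xi x ^+ d = 1.
    rewrite -(divnK p_dv_d) mulnC exprM.
    have -> : xi x ^+ p = 1 by rewrite -exp_cfunE // xiX cfun1E Gx.
    by rewrite expr1n.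
  case/(prim_rootP prim_zeta)=> i ->; exact: rpredX.
have Kval : 2%:R * (\sum_(x in D) xi x) + 1 \in Kring.
  by rewrite rpredD ?rpred1 // rpredM ?rpred_nat ?rpred_sum.
have /eqP := lin_char_SHDS_sqr xi shD xi_lin xi_neq1.
(* The chosen root [sqrtC] and [2 * s + 1], with [s] the sum of [xi] over [D], have the same square,
   so they agree up to a sign, which [K] absorbs. *)
rewrite -[X in _ == X]sqrtCK eq_sym eqf_sqr.
by case/orP=> /eqP->; rewrite -?[_ \in K]/(_ \in Kring) ?rpredN.
Qed.
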